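(* Let $A$ be a ring. Let $B$ be an $A$-algebra. Let $n\in\mathbb{N}^{+}$ and $m\in\mathbb{N}$. Let $v\in B$. Let $b_0,b_1,\ldots,b_{n-1}$ be $n$ elements of $A$, and let $u=\sum_{i=0}^{n-1}b_iv^i$. Assume that $vu$ is $m$-integral over $A$. Then $u$ is $nm$-integral over $A$.
   Context: All rings are commutative with unity, and ''$A$-algebra'' means commutative unital $A$-algebra (the structure map $A\to B$ need not be injective). $\mathbb{N}=\{0,1,2,\ldots\}$ and $\mathbb{N}^{+}=\{1,2,3,\ldots\}$. For a ring $A$, an $A$-algebra $B$ and $n\in\mathbb{N}$, an element $u\in B$ is called $n$-integral over $A$ if there exists a monic polynomial $P\in A[X]$ with $\deg P=n$ (that is, $P=X^n+\sum_{k=0}^{n-1}a_kX^k$ with $a_k\in A$) and $P(u)=0$. *)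

(* Defs.v *)
From HB Require Import structures.
From mathcomp Require Import all_boot all_order all_algebra.

Set Implicit Arguments.
Unset Strict Implicit.
Unset Printing Implicit Defensive.

Import GRing.Theory.
Local Open Scope ring_scope.

(* An A-algebra is a commutative ring B with its structure morphism
   iota : A -> B. The zero ring is allowed for both A and B; {poly A} and
   comAlgType exclude it, so the monic polynomial X^n + sum_(k < n) a_k X^k
   is given by its lower coefficients a. For nonzero rings this agrees with
   the {poly A} formulation, see n_integral_polyP. *)
Definition n_integral (A B : comPzRingType) (iota : {rmorphism A -> B})
    (n : nat) (u : B) : Prop :=
  exists a : 'I_n -> A, u ^+ n + \sum_(k < n) iota (a k) * u ^+ k = 0.

Lemma n_integral_polyP (A B : comNzRingType) (iota : {rmorphism A -> B})
    (n : nat) (u : B) :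
  n_integral iota n u <->
  exists P : {poly A},
    [/\ P \is monic, size P = n.+1 & root (map_poly iota P) u].
Proof.
split=> [[a au0]|[P [Pmon szP /rootP Pu0]]].
- have szQ : (size (\poly_(k < n) oapp a 0%R (insub k)) < size ('X^n : {poly A}))%N.
    by rewrite size_polyXn ltnS size_poly.
  exists ('X^n + \poly_(k < n) oapp a 0%R (insub k)); split.
  + by rewrite monicE lead_coefDl // lead_coefXn.
  + by rewrite size_polyDl // size_polyXn.
  + apply/rootP; rewrite rmorphD /= map_polyXn hornerD hornerXn -[RHS]au0.
    congr (_ + _); rewrite poly_def rmorph_sum horner_sum.
    apply: eq_bigr => k _.
    by rewrite -mul_polyC rmorphM /= map_polyC map_polyXn hornerCM hornerXn valK.
- exists (fun k : 'I_n => P`_k); rewrite -[RHS]Pu0.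
  rewrite (@horner_coef_wide _ n.+1); last first.
    by rewrite -szP; apply: size_poly.
  rewrite big_ord_recr /= addrC; congr (_ + _); last first.
    by apply: eq_bigr => k _; rewrite coef_map.
  have := monicP Pmon; rewrite lead_coefE szP /= => Pn1.
  by rewrite coef_map /= Pn1 rmorph1 mul1r.
Qed.

(* Main.v *)
Require Import Defs.
From HB Require Import structures.
From mathcomp Require Import all_boot all_order all_algebra.

(** Put [w = v * u].  Multiplying [u = \sum_(i < n) b_i v ^ i] by [u ^ (n - 1)]
    and absorbing each [v ^ i] into [u ^ i] gives
    [u ^ n = \sum_(i < n) b_i u ^ (n - 1 - i) w ^ i], a monic equation of
    degree [n] for [u] over [A[w]].  Since [w] is [m]-integral over [A], the
    [n * m] products [u ^ k * w ^ j] with [k < n] and [j < m] span an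
    [A]-submodule of [B] that is stable under multiplication by [u] and
    contains [1] ([mul_span_monomials] and [span_expM]).  The Cayley-Hamilton
    argument ([n_integral_of_span]) then provides a monic equation for [u] of
    degree [n * m], namely the characteristic polynomial of a matrix over [A]
    describing multiplication by [u] on these generators. *)

Set Implicit Arguments.
Unset Strict Implicit.

Import GRing.Theory.
Local Open Scope ring_scope.

Definition in_span (A B : comPzRingType) (iota : {rmorphism A -> B})
    (T : finType) (x : T -> B) (y : B) : Prop :=
  exists c : T -> A, y = \sum_t iota (c t) * x t.

Section Span.
Variables (A B : comPzRingType) (iota : {rmorphism A -> B}).
Variables (T : finType) (x : T -> B).
Local Notation span := (in_span iota x).

Lemma in_span_gen (t : T) : span (x t).
Proof.
exists (fun s => (s == t)%:R); rewrite (bigD1 t) //= eqxx rmorph1 mul1r.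
by rewrite big1 ?addr0 // => s /negPf ->; rewrite rmorph0 mul0r.
Qed.

Lemma in_span_lin (I : finType) (a : I -> A) (y : I -> B) :
  (forall i, span (y i)) -> span (\sum_i iota (a i) * y i).
Proof.
move=> /fin_all_exists [c yE]; exists (fun t => \sum_i a i * c i t).
under eq_bigr => i _ do rewrite yE mulr_sumr.
rewrite exchange_big; apply: eq_bigr => t _ /=.
rewrite rmorph_sum mulr_suml; apply: eq_bigr => i _.
by rewrite rmorphM mulrA.
Qed.

Lemma in_spanN (y : B) : span y -> span (- y).
Proof.
case=> c ->; exists (fun t => - c t); rewrite -sumrN.
by apply: eq_bigr => t _; rewrite rmorphN mulNr.
Qed.

End Span.

(** If [x] is the column of generators, then [u%:M - M] kills [x]; multiplying
    by the adjugate, its determinant kills the whole span of [x], hence [1],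
    hence vanishes.  This determinant is the value at [u] of the
    characteristic polynomial of [M]. *)
Lemma n_integral_of_span_nz (A B : comNzRingType) (iota : {rmorphism A -> B})
    (T : finType) (x : T -> B) (u : B) :
  (forall t, in_span iota x (u * x t)) -> in_span iota x 1 ->
  n_integral iota #|T| u.
Proof.
move=> /fin_all_exists [c uxE] [d oneE]; apply/n_integral_polyP.
pose M : 'M[A]_#|T| := \matrix_(i, j) c (enum_val i) (enum_val j).
pose X : 'cV[B]_#|T| := \col_i x (enum_val i).
pose D : 'M[B]_#|T| := u%:M - map_mx iota M.
exists (char_poly M); split; [exact: char_poly_monic | exact: size_char_poly |].
have detE : (map_poly iota (char_poly M)).[u] = \det D.
  rewrite map_char_poly /char_poly -[LHS]/(horner_eval u _) -det_map_mx.
  congr (\det _); apply/matrixP => i j; rewrite !mxE /= /horner_eval.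
  by rewrite hornerD hornerN hornerC hornerMn hornerX.
have DX0 : D *m X = 0.
  apply/matrixP => i k; rewrite /D mulmxBl mul_scalar_mx !mxE uxE.
  apply/eqP; rewrite subr_eq0; apply/eqP.
  rewrite (reindex (@enum_val T T)); last exact/onW_bij/enum_val_bij.
  by apply: eq_bigr => j _; rewrite !mxE.
have detX0 : \det D *: X = 0.
  by rewrite -mul_scalar_mx -mul_adj_mx -mulmxA DX0 mulmx0.
apply/rootP; rewrite detE -[LHS]mulr1 oneE mulr_sumr big1 // => t _.
have /matrixP/(_ (enum_rank t) 0) := detX0; rewrite !mxE enum_rankK => Dx0.
by rewrite mulrCA Dx0 mulr0.
Qed.

Lemma n_integral_of_span (A B : comPzRingType) (iota : {rmorphism A -> B})
    (T : finType) (x : T -> B) (u : B) :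
  (forall t, in_span iota x (u * x t)) -> in_span iota x 1 ->
  n_integral iota #|T| u.
Proof.
(* Every equation holds in the zero ring; otherwise both rings are nonzero
   and the characteristic polynomial over [A] makes sense. *)
have [B10|B1_neq0] := eqVneq (1 : B) 0.
  by move=> _ _; exists (fun=> 0); rewrite -[LHS]mul1r B10 mul0r.
have A1_neq0 : (1 : A) != 0.
  by apply: contra_neq B1_neq0 => A10; rewrite -(rmorph1 iota) A10 rmorph0.
pose A' : comNzRingType :=
  HB.pack (GRing.ComPzRing.sort A) (GRing.PzSemiRing_isNonZero.Build A A1_neq0).
pose B' : comNzRingType :=
  HB.pack (GRing.ComPzRing.sort B) (GRing.PzSemiRing_isNonZero.Build B B1_neq0).
exact: (@n_integral_of_span_nz A' B' iota).
Qed.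

Section Monomials.
Variables (A B : comPzRingType) (iota : {rmorphism A -> B}) (n m : nat).
Variables (u w : B).

Definition monomials (p : 'I_n * 'I_m) : B := u ^+ p.1 * w ^+ p.2.
Local Notation span := (in_span iota monomials).

(** The integral equation of [w] rewrites every power [w ^+ j] with [m <= j]
    in terms of lower ones.  For [m = 0] it says [1 = 0], and the span is that
    of the empty family. *)
Lemma span_expM (k j : nat) :
  n_integral iota m w -> (k < n)%N -> span (u ^+ k * w ^+ j).
Proof.
case=> a wE lt_kn; elim/ltn_ind: j => j IHj.
have [lt_jm|le_mj] := ltnP j m.
  exact: (in_span_gen iota monomials (Ordinal lt_kn, Ordinal lt_jm)).
have -> : u ^+ k * w ^+ j
    = - \sum_(l < m) iota (a l) * (u ^+ k * w ^+ (j - m + l)).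
  rewrite -{1}(subnK le_mj) exprD; move/eqP: wE; rewrite addr_eq0 => /eqP ->.
  rewrite !mulrN !mulr_sumr; congr (- _); apply: eq_bigr => l _.
  by rewrite exprD (mulrCA (w ^+ (j - m))) [LHS]mulrCA.
apply: in_spanN; apply: in_span_lin => l; apply: IHj.
by rewrite -{2}(subnK le_mj) ltn_add2l.
Qed.

End Monomials.

(** Multiplying by [u] raises the exponent [k] of [u]; only [k = n - 1] leaves
    the range of the generators, and there the expansion of one factor [u]
    in powers of [v] is what brings the exponent back below [n]. *)
Lemma mul_span_monomials (A B : comPzRingType) (iota : {rmorphism A -> B})
    (n m : nat) (v : B) (b : 'I_n -> A) (u : B) (p : 'I_n * 'I_m) :
  u = \sum_(i < n) iota (b i) * v ^+ i ->
  n_integral iota m (v * u) ->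
  in_span iota (@monomials B n m u (v * u)) (u * @monomials B n m u (v * u) p).
Proof.
case: p => k j uE wP; rewrite /monomials /= mulrA -exprS.
have [lt_k1n|le_nk1] := ltnP k.+1 n; first exact: span_expM.
have kE : n = k.+1 by apply/eqP; rewrite eqn_leq le_nk1 ltn_ord.
(* Here [k = n - 1], and [v ^ i * u ^ k = w ^ i * u ^ (k - i)] as [i <= k]. *)
have -> : u ^+ k.+1 * (v * u) ^+ j
    = \sum_(i < n) iota (b i) * (u ^+ (k - i) * (v * u) ^+ (i + j)).
  rewrite exprS {1}uE !mulr_suml; apply: eq_bigr => i _.
  have le_ik : (i <= k)%N by rewrite -ltnS -kE.
  rewrite -{1}(subnK le_ik) !exprD [(v * u) ^+ i]exprMn -!mulrA.
  by congr (_ * _); rewrite mulrCA; congr (_ * _); rewrite !mulrA.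
apply: in_span_lin => i; apply: span_expM => //.
exact: leq_ltn_trans (leq_subr _ _) (ltn_ord k).
Qed.

Unset Implicit Arguments.

Theorem corollary1p13 (A B : comPzRingType) (iota : {rmorphism A -> B})
    (n m : nat) (hn : (0 < n)%N) (v : B) (b : 'I_n -> A) (u : B)
    (hu : u = \sum_(i < n) iota (b i) * v ^+ i)
    (hvu : n_integral iota m (v * u)) :
  n_integral iota (n * m)%N u.
Proof.
have cardE : #|{: 'I_n * 'I_m}| = (n * m)%N by rewrite card_prod !card_ord.
rewrite -cardE; apply: (n_integral_of_span (x := @monomials B n m u (v * u))).
- by move=> p; apply: mul_span_monomials hu hvu.
- have := span_expM u 0 hvu hn.
  by rewrite !expr0 mulr1.
Qed.
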